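(* Consider the deterministic input-affine system $\dot x(t)=f(x(t))+g(x(t))u(t)$ with state $x(t)\in\mathbb{R}^n$ and $m$ inputs, and the control input $$u(t)\,dt=v(t)\,dt+B(x(t))\circ dw(t),$$ where $v(t)\in\mathbb{R}^m$ is a new input vector and $B:\mathbb{R}^n\to\mathbb{R}^m$ is (a part of) the diffusion coefficient. If $B(x)$ is once differentiable, $B(0)=0$, and there exists a twice differentiable positive definite function $V:\mathbb{R}^n\to\mathbb{R}$ such that $$\frac12 B(x)^T g(x)^T\left[\frac{\partial}{\partial x}\left[\frac{\partial V(x)}{\partial x}\right]^T\right]g(x)B(x)+\frac12\frac{\partial V(x)}{\partial x}\,\frac{\partial (g(x)B(x))}{\partial x}\,g(x)B(x)<-L_fV(x)$$ for all $x\in\{x\in\mathbb{R}^n\setminus\{0\}: L_gV(x)=0\}$, then $V(x)$ is a stochastic control Lyapunov function of the deterministic system with this control input, i.e. of the stochastic system with control $v$ obtained by substituting the control input into the deterministic system.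
   Context: Here $f:\mathbb{R}^n\to\mathbb{R}^n$ and $g:\mathbb{R}^n\to\mathbb{R}^{n\times m}$. $w(t)\in\mathbb{R}$ is a one-dimensional standard Wiener process; $\circ\,dw$ denotes the Stratonovich differential and $dw$ the Ito differential. For $V:\mathbb{R}^n\to\mathbb{R}$, $L_fV(x)=\frac{\partial V(x)}{\partial x}f(x)$ and $L_gV(x)=\frac{\partial V(x)}{\partial x}g(x)$, with $\frac{\partial V}{\partial x}$ a row vector; $\frac{\partial}{\partial x}\big[\frac{\partial V}{\partial x}\big]^T$ is the Hessian of $V$. Substituting the control input into the deterministic system gives the stochastic system whose Ito form is $$dx=\Big\{f(x)+g(x)v+\tfrac12\tfrac{\partial (g(x)B(x))}{\partial x}g(x)B(x)\Big\}dt+g(x)B(x)\,dw.$$ For a control stochastic system in Ito form $dx=\{\tilde f(x)+g(x)v\}dt+\sigma(x)\,dw$ with control $v\in\mathbb{R}^m$ (the general setting for such systems is that $\tilde f$, $g$, $\sigma$ are Lipschitz, $\tilde f(0)=0$, $\sigma(0)=0$, and $|\tilde f(x)|+|g(x)|+|\sigma(x)|\le K(1+|x|)$ for all $x\in\mathbb{R}^n$ and some constant $K\ge 0$), the infinitesimal generator is $$(\mathcal{L}V)(x)=L_{\tilde f}V(x)+L_gV(x)\,v+\tfrac12\sigma(x)^T\Big[\tfrac{\partial}{\partial x}\big[\tfrac{\partial V}{\partial x}\big]^T\Big]\sigma(x).$$ A function $V:D\subset\mathbb{R}^n\to\mathbb{R}$ is said to be a stochastic control Lyapunov function of this system if $V(x)$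 is twice differentiable in $x\in D$, proper in $D$, and $(\mathcal{L}V)(x)$ is negative definite in $x\in D\cap\{L_gV(x)=0\}$.
   Formalization: Properness of V in D, which the definition of a stochastic control Lyapunov function requires, is added as a hypothesis: it does not follow from positive definiteness (f=-x, g=1, B=0, V=x²/(1+x²) on the line); the conclusion is for every D in which V is proper. *)

(* Defs.v *)
From HB Require Import structures.
From mathcomp Require Import all_boot all_order all_algebra.
From mathcomp Require Import all_classical all_reals all_analysis.

Set Implicit Arguments.
Unset Strict Implicit.
Unset Printing Implicit Defensive.

Import Order.TTheory GRing.Theory Num.Theory.
Import numFieldNormedType.Exports.

Local Open Scope classical_set_scope.
Local Open Scope ring_scope.

(* Points of R^n are column vectors. The library's jacobian acts on row
   vectors, hence is the transpose of dF/dx; the matrix of partial derivatives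
   below has entry (i, j) equal to dF_i/dx_j. *)
Definition jac (R : realType) (n p : nat) (F : 'cV[R]_n -> 'cV[R]_p)
    (x : 'cV[R]_n) : 'M[R]_(p, n) :=
  \matrix_(i, j) 'D_(delta_mx j 0) (fun y => F y i 0) x.

(* dV/dx, a row vector *)
Definition grad (R : realType) (n : nat) (V : 'cV[R]_n -> R)
    (x : 'cV[R]_n) : 'rV[R]_n :=
  \row_j 'D_(delta_mx j 0) V x.

Definition hess (R : realType) (n : nat) (V : 'cV[R]_n -> R)
    (x : 'cV[R]_n) : 'M[R]_n :=
  jac (fun y => (grad V y)^T) x.

(* L_F V, for a matrix-valued F; it is a 1 x 1 matrix when F is a vector
   field. *)
Definition lie (R : realType) (n p : nat) (F : 'cV[R]_n -> 'M[R]_(n, p))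
    (V : 'cV[R]_n -> R) (x : 'cV[R]_n) : 'rV[R]_p :=
  grad V x *m F x.

Definition twice_differentiable_at (R : realType) (n : nat)
    (V : 'cV[R]_n -> R) (x : 'cV[R]_n) : Prop :=
  (\forall y \near x, differentiable V y) /\
  differentiable (fun y => (grad V y)^T) x.

Definition positive_definite (R : realType) (n : nat)
    (V : 'cV[R]_n -> R) : Prop :=
  V 0 = 0 /\ forall x, x != 0 -> 0 < V x.

(* A is not required to contain the origin; the value at the origin is
   constrained only when it does. *)
Definition negative_definite_on (R : realType) (n : nat)
    (A : set 'cV[R]_n) (W : 'cV[R]_n -> R) : Prop :=
  (A 0 -> W 0 = 0) /\ forall x, A x -> x != 0 -> W x < 0.

(* the restriction of V to D is a proper map; D need not be closed *)
Definition proper_in (R : realType) (n : nat) (D : set 'cV[R]_n)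
    (V : 'cV[R]_n -> R) : Prop :=
  forall K : set R, compact K -> compact (D `&` V @^-1` K).

(* Coefficients of dx = (drift(x) + input(x) v) dt + diffusion(x) dw, with a
   one-dimensional Wiener process w; the last term is read either in the Ito
   or in the Stratonovich sense. *)
Record control_sde (R : realType) (n m : nat) := ControlSDE {
  drift : 'cV[R]_n -> 'cV[R]_n ;
  input : 'cV[R]_n -> 'M[R]_(n, m) ;
  diffusion : 'cV[R]_n -> 'cV[R]_n }.

(* From Stratonovich to Ito coefficients: the drift gains the Wong-Zakai
   correction (1/2) (d sigma / dx) sigma. *)
Definition ito_of_stratonovich (R : realType) (n m : nat)
    (S : control_sde R n m) : control_sde R n m :=
  ControlSDE
    (fun x => drift S x + 2^-1 *: (jac (diffusion S) x *m diffusion S x))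
    (input S) (diffusion S).

(* Stratonovich coefficients of dx = f(x) dt + g(x) u dt after the
   substitution u dt = v dt + B(x) o dw. *)
Definition substitute_input (R : realType) (n m : nat)
    (f : 'cV[R]_n -> 'cV[R]_n) (g : 'cV[R]_n -> 'M[R]_(n, m))
    (B : 'cV[R]_n -> 'cV[R]_m) : control_sde R n m :=
  ControlSDE f g (fun x => g x *m B x).

(* infinitesimal generator of a system in Ito form, with control value v *)
Definition generator (R : realType) (n m : nat) (S : control_sde R n m)
    (V : 'cV[R]_n -> R) (v : 'cV[R]_m) (x : 'cV[R]_n) : R :=
  (lie (drift S) V x) 0 0 + (lie (input S) V x *m v) 0 0 +
  2^-1 * ((diffusion S x)^T *m hess V x *m diffusion S x) 0 0.

(* stochastic control Lyapunov function in D of a system in Ito form; on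
   {L_g V = 0} the generator does not depend on the control value v *)
Definition is_sclf (R : realType) (n m : nat) (S : control_sde R n m)
    (D : set 'cV[R]_n) (V : 'cV[R]_n -> R) : Prop :=
  [/\ forall x, D x -> twice_differentiable_at V x,
      proper_in D V &
      forall v : 'cV[R]_m,
        negative_definite_on (D `&` [set x | lie (input S) V x = 0])
          (generator S V v)].

(* Main.v *)
Require Import Defs.
From mathcomp Require Import all_boot all_order all_algebra.
From mathcomp Require Import all_classical all_reals all_analysis.

Import Order.TTheory GRing.Theory Num.Theory.
Import numFieldNormedType.Exports.

Local Open Scope classical_set_scope.
Local Open Scope ring_scope.

(** Write [sigma x = g x *m B x] for the diffusion coefficient. Passing from
    the Stratonovich to the Ito form adds [1/2 (d sigma/dx) sigma] to the drift
    [f], so the generator of the resulting system is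
      [L_f V + L_g V v + 1/2 dV/dx (d sigma/dx) sigma
         + 1/2 sigma^T (hess V) sigma].
    Where [L_g V] vanishes the control term disappears, and away from the origin
    the assumed inequality says exactly that the remaining sum is negative
    ([generator_substitute_input]). At the origin the generator
    vanishes: every first-order term contains the gradient of [V], which is zero
    because a positive definite [V] attains its minimum there ([grad_at_min]),
    and the second-order term contains [sigma 0 = g 0 *m B 0 = 0]. *)

(** Difference quotients along positive multiples of [v] are nonnegative; a
    differentiable function has the opposite derivative along [- v], which
    forces equality. *)
Lemma derive_at_min (R : realType) (U : normedModType R) (V : U -> R)
    (a v : U) :
  differentiable V a -> (forall y, V a <= V y) -> 'D_v V a = 0.
Proof.
move=> dV Vmin.
have D_ge0 w : 0 <= 'D_w V a.
  have dVw := @diff_derivable _ _ _ _ a w dV.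
  apply: (cvgr_to_ge (cvg_dnbhs_at_right dVw)); near=> h.
  by apply: mulr_ge0; rewrite ?subr_ge0 ?invr_ge0 //=.
apply/eqP; rewrite eq_le D_ge0 andbT -oppr_ge0.
by have := D_ge0 (- v); rewrite !deriveE // linearN.
Unshelve. all: by end_near. Qed.

Lemma grad_at_min (R : realType) (n : nat) (V : 'cV[R]_n -> R)
    (a : 'cV[R]_n) :
  differentiable V a -> (forall y, V a <= V y) -> grad V a = 0.
Proof. by move=> dV Vmin; apply/rowP => j; rewrite !mxE derive_at_min. Qed.

(** The two terms produced by the noise, the Hessian one and the drift
    correction, are grouped in the form in which the Lyapunov inequality bounds
    them. *)
Lemma generator_substitute_input (R : realType) (n m : nat)
    (f : 'cV[R]_n -> 'cV[R]_n) (g : 'cV[R]_n -> 'M[R]_(n, m))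
    (B : 'cV[R]_n -> 'cV[R]_m) (V : 'cV[R]_n -> R) (v : 'cV[R]_m)
    (x : 'cV[R]_n) :
  generator (ito_of_stratonovich (substitute_input f g B)) V v x =
  (lie f V x) 0 0 + (lie g V x *m v) 0 0 +
  (2^-1 * ((B x)^T *m (g x)^T *m hess V x *m g x *m B x) 0 0 +
   2^-1 * (grad V x *m jac (fun y => g y *m B y) x *m g x *m B x) 0 0).
Proof.
rewrite /generator /lie /= mulmxDr -scalemxAr trmx_mul !mulmxA.
rewrite [X in X + _ + _ = _]mxE [X in _ + X + _ + _ = _]mxE.
by rewrite -!addrA; congr (_ + _); rewrite addrCA; congr (_ + _); exact: addrC.
Qed.

(* Positive definiteness does not make V proper (x^2 / (1 + x^2) on the line),
   so the conclusion is stated in every D in which V is proper: in D = R^n when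
   V is radially unbounded, and always in every compact D. *)
Theorem theorem3p1 (R : realType) (n m : nat)
    (f : 'cV[R]_n -> 'cV[R]_n) (g : 'cV[R]_n -> 'M[R]_(n, m))
    (B : 'cV[R]_n -> 'cV[R]_m) (V : 'cV[R]_n -> R)
    (B_diff : forall x, differentiable B x)
    (B0 : B 0 = 0)
    (V_diff2 : forall x, twice_differentiable_at V x)
    (V_posdef : positive_definite V)
    (V_ineq : forall x, x != 0 -> lie g V x = 0 ->
      2^-1 * ((B x)^T *m (g x)^T *m hess V x *m g x *m B x) 0 0 +
      2^-1 * (grad V x *m jac (fun y => g y *m B y) x *m g x *m B x) 0 0
      < - (lie f V x) 0 0) :
  forall D : set 'cV[R]_n, proper_in D V ->
    is_sclf (ito_of_stratonovich (substitute_input f g B)) D V.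
Proof.
move=> D V_proper; split=> // v.
have grad0 : grad V 0 = 0.
  have [V_diff _] := V_diff2 0; have [V0 V_gt0] := V_posdef.
  apply: grad_at_min => [|y]; first exact: nbhs_singleton V_diff.
  by rewrite V0; have [->|/V_gt0/ltW//] := eqVneq y 0; rewrite V0.
split=> [_|x [_ /= Lg0] x_neq0].
  rewrite generator_substitute_input /lie grad0 B0 !mul0mx !mulmx0.
  by rewrite !mxE !mulr0 !addr0.
rewrite generator_substitute_input Lg0 mul0mx [X in _ + X + _]mxE addr0.
by rewrite addrC -ltrBrDr sub0r; exact: V_ineq.
Qed.
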